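(* Let $m(x)=e^{x^2/2}\int_x^{\infty}e^{-t^2/2}\,dt$ be the Mills ratio of the standard normal distribution. Then for all $x>0$ with $x\neq\sqrt{2}$ $$m(x)<\frac{5x^2-3-\sqrt{x^4+18x^2+9}}{4x(x^2-2)}.$$ *)

(* Defs.v *)
(* Concrete reals of Stdlib, with Coquelicot. *)
From Stdlib Require Import Reals.
From Coquelicot Require Import Coquelicot.
Open Scope R_scope.

(* [RInt_gen] is total; here the improper integral converges for every [x],
   so the value is the genuine limit of the integrals over [x, b]. *)
Definition mills (x : R) : R :=
  exp (x ^ 2 / 2) *
  RInt_gen (fun t : R => exp (- (t ^ 2 / 2))) (at_point x) (Rbar_locally p_infty).

(* Main.v *)
Require Import Defs.
From Stdlib Require Import Reals Lra.
From Coquelicot Require Import Coquelicot.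
Open Scope R_scope.

(** The right-hand side has a removable singularity at [sqrt 2]: multiplying
    numerator and denominator by the conjugate [5 x^2 - 3 + S], where
    [S = sqrt (x^4 + 18 x^2 + 9)], turns it into [B x = 6 x / (5 x^2 - 3 + S)],
    which is smooth and positive on [x > 0] ([bound_conjugate]).

    Let [G t = B t * exp (- t^2 / 2)].  If [- G' > exp (- t^2 / 2)] for all
    [t > 0], then integrating from [x] to infinity and using [G > 0] gives
    [mills x < B x].  The condition reads [B' - t B + 1 < 0], a differential
    inequality satisfied with equality by the Mills ratio itself.  After
    clearing denominators and reducing by the quadratic equation
    of [5 t^2 - 3 + S], it becomes, with [y = t^2],
    [y^2 + 15 y - 18 < (y + 6) S] ([key_inequality]), which holds because
    [(y + 6)^2 S^2 - (y^2 + 15 y - 18)^2 = 72 y^2 + 1296 y > 0].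

    The map [b |-> G b + RInt gauss x b] is thus strictly decreasing
    ([gauss_bound_decreasing]); its value at [x + 1] is a bound, strictly below
    [G x], for all the integrals up to [b >= x + 1].  This keeps the inequality
    strict in the limit and also proves that the limit exists
    ([is_RInt_gen_nonneg_bounded]). *)

Definition gauss (t : R) : R := exp (- (t ^ 2 / 2)).

Definition radical (x : R) : R := sqrt (x ^ 4 + 18 * x ^ 2 + 9).

Definition bound (x : R) : R := 6 * x / (5 * x ^ 2 - 3 + radical x).

Lemma radicand_pos (x : R) : 0 < x ^ 4 + 18 * x ^ 2 + 9.
Proof. nra. Qed.

Lemma radical_sqr (x : R) : radical x * radical x = x ^ 4 + 18 * x ^ 2 + 9.
Proof. apply sqrt_sqrt; generalize (radicand_pos x); lra. Qed.

Lemma radical_pos (x : R) : 0 < radical x.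
Proof. apply sqrt_lt_R0, radicand_pos. Qed.

Lemma bound_denominator_pos (x : R) : 0 < x -> 0 < 5 * x ^ 2 - 3 + radical x.
Proof.
intros hx.
assert (3 < radical x) by (generalize (radical_sqr x) (radical_pos x); nra).
nra.
Qed.

Lemma bound_pos (x : R) : 0 < x -> 0 < bound x.
Proof.
intros hx; apply Rdiv_lt_0_compat; [lra | now apply bound_denominator_pos].
Qed.

Lemma bound_conjugate (x : R) : 0 < x -> x <> sqrt 2 ->
  (5 * x ^ 2 - 3 - radical x) / (4 * x * (x ^ 2 - 2)) = bound x.
Proof.
intros hx hx2.
assert (hd := bound_denominator_pos x hx).
assert (hs := radical_sqr x).
assert (x ^ 2 - 2 <> 0).
{ intros h; apply hx2; symmetry; apply sqrt_lem_1; nra. }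
unfold bound.
apply (Rmult_eq_reg_r (4 * x * (x ^ 2 - 2) * (5 * x ^ 2 - 3 + radical x))).
- transitivity ((5 * x ^ 2 - 3 - radical x) * (5 * x ^ 2 - 3 + radical x)).
  + field; repeat split; lra.
  + transitivity (6 * x * (4 * x * (x ^ 2 - 2))); [nra | field; lra].
- apply Rmult_integral_contrapositive_currified; [|lra].
  apply Rmult_integral_contrapositive_currified; lra.
Qed.

(** Only a positive left-hand side matters, and then the squares compare:
    their difference is [72 y^2 + 1296 y]. *)
Lemma key_inequality (y s : R) : 0 < y -> 0 < s ->
  s * s = y ^ 2 + 18 * y + 9 -> y ^ 2 + 15 * y - 18 < (y + 6) * s.
Proof.
intros hy hs hss.
apply Rnot_le_lt; intros hle.
assert (0 < (y + 6) * s) by nra.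
assert (h : ((y + 6) * s) * ((y + 6) * s)
            <= (y ^ 2 + 15 * y - 18) * (y ^ 2 + 15 * y - 18))
  by (apply Rmult_le_compat; lra).
replace (((y + 6) * s) * ((y + 6) * s)) with ((y + 6) * (y + 6) * (s * s))
  in h by ring.
rewrite hss in h; nra.
Qed.

(** The quotient rule, with [(2 x^3 + 18 x) / radical x] the derivative of the
    radical. *)
Definition bound_derivative (x : R) : R :=
  let d := 5 * x ^ 2 - 3 + radical x in
  6 / d - 6 * x * (10 * x + (2 * x ^ 3 + 18 * x) / radical x) / d ^ 2.

Lemma is_derive_bound (x : R) :
  0 < x -> is_derive bound x (bound_derivative x).
Proof.
intros hx.
assert (hd := bound_denominator_pos x hx).
assert (hs := radical_pos x).
unfold bound, radical in *.
auto_derive.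
- repeat split; [apply radicand_pos | simpl in hd; lra].
- unfold bound_derivative, radical.
  change (x * (x * (x * (x * 1)))) with (x ^ 4).
  change (x * (x * 1)) with (x ^ 2).
  field; lra.
Qed.

Lemma bound_differential_inequality (x : R) :
  0 < x -> bound_derivative x - x * bound x + 1 < 0.
Proof.
intros hx.
assert (hd := bound_denominator_pos x hx).
assert (hs := radical_pos x).
assert (hss := radical_sqr x).
unfold bound_derivative, bound.
set (s := radical x) in *.
set (d := 5 * x ^ 2 - 3 + s) in *.
assert (hy : 0 < x ^ 2) by nra.
assert (hk : (x ^ 2) ^ 2 + 15 * x ^ 2 - 18 < (x ^ 2 + 6) * s).
{ apply key_inequality; [lra | lra | rewrite hss; ring]. }
replace (6 / d - 6 * x * (10 * x + (2 * x ^ 3 + 18 * x) / s) / d ^ 2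
         - x * (6 * x / d) + 1)
  with (4 * x ^ 2 * ((x ^ 2) ^ 2 + 15 * x ^ 2 - 18 - (x ^ 2 + 6) * s)
        / (s * d ^ 2)).
- assert (0 < s * d ^ 2) by (apply Rmult_lt_0_compat; nra).
  apply Rdiv_neg_pos; nra.
- apply (Rmult_eq_reg_r (s * d ^ 2)); [|nra].
  transitivity (4 * x ^ 2 * ((x ^ 2) ^ 2 + 15 * x ^ 2 - 18 - (x ^ 2 + 6) * s)).
  + field; lra.
  + transitivity (6 * d * s * (1 - x ^ 2) + d * d * s
                  - 60 * x ^ 2 * s - 12 * x ^ 2 * (x ^ 2 + 9));
      [|field; lra].
    (* The quadratic with roots [d] and its conjugate [d - 2 s] eliminates
       [d * d]; what remains is linear in [d]. *)
    replace (d * d) with (2 * (5 * x ^ 2 - 3) * d - 24 * x ^ 2 * (x ^ 2 - 2))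
      by (unfold d; nra).
    transitivity (4 * x ^ 2 * (s * s - (x ^ 2 + 6) * s - 3 * (x ^ 2 + 9)));
      [rewrite hss; ring | unfold d; ring].
Qed.

Lemma continuous_gauss (t : R) : continuous gauss t.
Proof. apply (ex_derive_continuous gauss t); unfold gauss; auto_derive; trivial. Qed.

Lemma gauss_pos (t : R) : 0 < gauss t.
Proof. apply exp_pos. Qed.

Lemma ex_RInt_gauss (a b : R) : ex_RInt gauss a b.
Proof. apply (ex_RInt_continuous gauss); intros; apply continuous_gauss. Qed.

(** The derivative of [b |-> bound b * gauss b + RInt gauss x b] is
    [gauss b * (bound' b - b * bound b + 1)], whose second factor is negative
    by [bound_differential_inequality]. *)
Lemma gauss_bound_decreasing (x a b : R) : 0 < a -> a < b ->
  bound b * gauss b + RInt gauss x b < bound a * gauss a + RInt gauss x a.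
Proof.
intros ha hab.
apply Ropp_lt_cancel.
apply (incr_function (fun t => - (bound t * gauss t + RInt gauss x t))
  0 p_infty
  (fun t => - (gauss t * (bound_derivative t - t * bound t + 1)))); simpl;
  [| | assumption | assumption | trivial].
- intros t ht _.
  apply (is_derive_opp (fun t => bound t * gauss t + RInt gauss x t)).
  replace (gauss t * (bound_derivative t - t * bound t + 1))
    with (plus (plus (mult (bound_derivative t) (gauss t))
                     (mult (bound t) (- t * gauss t)))
               (gauss t)) by (unfold plus, mult; simpl; ring).
  apply (is_derive_plus (fun t => bound t * gauss t) (RInt gauss x)).
  + apply (is_derive_mult bound gauss).
    * now apply is_derive_bound.
    * unfold gauss; auto_derive; [trivial |].
      change (t * (t * 1) * / 2) with (t ^ 2 / 2); field.
    * intros n m; apply Rmult_comm.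
  + apply (is_derive_RInt gauss (RInt gauss x) x).
    * apply filter_forall; intros b'.
      apply (RInt_correct gauss), ex_RInt_gauss.
    * apply continuous_gauss.
- intros t ht _.
  generalize (bound_differential_inequality t ht) (gauss_pos t); nra.
Qed.

(** The partial integrals [b |-> RInt f a b] are nondecreasing, so a bound that
    holds from some point [c] on gives convergence to their supremum. *)
Lemma is_RInt_gen_nonneg_bounded (f : R -> R) (a c M : R) :
  (forall u v, ex_RInt f u v) ->
  (forall t, 0 <= f t) ->
  (forall b, c <= b -> RInt f a b <= M) ->
  exists l, is_RInt_gen f (at_point a) (Rbar_locally p_infty) l /\ l <= M.
Proof.
intros hf hpos hM.
assert (hmono : forall u v, u <= v -> RInt f a u <= RInt f a v).
{ intros u v huv.
  rewrite <- (RInt_Chasles f a u v) by apply hf.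
  assert (0 <= RInt f u v) by (apply RInt_ge_0; auto).
  unfold plus; simpl; lra. }
destruct (completeness (fun r => exists b, c <= b /\ r = RInt f a b))
  as [l [hub hlub]].
- exists M; intros r [b [hb ->]]; auto.
- exists (RInt f a c), c; split; [lra | trivial].
- exists l; split.
  + intros P [eps hP].
    assert (hb0 : exists b0, c <= b0 /\ l - eps < RInt f a b0).
    { apply Classical_Prop.NNPP; intros hn.
      assert (l <= l - eps).
      { apply hlub; intros r [b [hb ->]].
        apply Rnot_lt_le; intros hlt; apply hn; now exists b. }
      generalize (cond_pos eps); lra. }
    destruct hb0 as [b0 [hcb0 hb0]].
    exists (fun u => u = a) (fun v => b0 < v);
      [reflexivity | now exists b0 |].
    intros u v -> hv; simpl.
    exists (RInt f a v); split; [apply (RInt_correct f), hf |].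
    apply hP.
    change (Rabs (RInt f a v - l) < eps).
    assert (RInt f a v <= l) by (apply hub; exists v; split; lra).
    assert (RInt f a b0 <= RInt f a v) by (apply hmono; lra).
    apply Rabs_def1; generalize (cond_pos eps); lra.
  + apply hlub; intros r [b [hb ->]]; auto.
Qed.

Lemma mills_lt_bound (x : R) : 0 < x -> mills x < bound x.
Proof.
intros hx.
(* Any point strictly beyond [x] would serve in place of [x + 1]. *)
set (M := bound (x + 1) * gauss (x + 1) + RInt gauss x (x + 1)).
assert (hM : M < bound x * gauss x).
{ unfold M.
  generalize (gauss_bound_decreasing x x (x + 1) hx ltac:(lra)).
  rewrite (RInt_point x gauss); unfold zero; simpl; lra. }
destruct (is_RInt_gen_nonneg_bounded gauss x (x + 1) M) as [l [hl hlM]].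
- exact ex_RInt_gauss.
- intros t; generalize (gauss_pos t); lra.
- intros b hb.
  assert (0 < bound b * gauss b)
    by (apply Rmult_lt_0_compat; [apply bound_pos; lra | apply gauss_pos]).
  destruct (Req_dec b (x + 1)) as [-> | hne].
  + unfold M; lra.
  + generalize (gauss_bound_decreasing x (x + 1) b ltac:(lra) ltac:(lra)).
    unfold M; lra.
- unfold mills; fold gauss.
  rewrite (is_RInt_gen_unique gauss l hl).
  replace (bound x) with (exp (x ^ 2 / 2) * (bound x * gauss x)).
  + apply Rmult_lt_compat_l; [apply exp_pos | lra].
  + unfold gauss; rewrite exp_Ropp.
    field; generalize (exp_pos (x ^ 2 / 2)); lra.
Qed.

Theorem mainTheorem6 (x : R) (hx : 0 < x) (hx2 : x <> sqrt 2) :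
  mills x <
  (5 * x ^ 2 - 3 - sqrt (x ^ 4 + 18 * x ^ 2 + 9)) / (4 * x * (x ^ 2 - 2)).
Proof.
fold (radical x).
rewrite (bound_conjugate x hx hx2).
exact (mills_lt_bound x hx).
Qed.
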